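(* Let $\mathcal{A}$ be a finite group and $m$ a positive integer. Then the number $\mathcal{E}^w(\mathcal{A},m)$ of weak equivalence classes of Cayley graphs $C(\mathcal{A},\Omega)$ of degree $m$ satisfies $$\mathcal{E}^w(\mathcal{A},m)=\sum_{k=0}^{\lfloor m/2\rfloor}|G_{m,k}(\mathcal{A})/\mathrm{Aut}(\mathcal{A})|=\sum_{k=0}^{\lfloor m/2\rfloor}\frac{\sum_{(\alpha,\sigma,\tau)\in\mathrm{Aut}(\mathcal{A})\times\mathcal{K}_k}|F_{(\alpha,\sigma,\tau)}(m,k,\mathcal{A})|}{|\mathrm{Aut}(\mathcal{A})|\,k!\,(m-2k)!},$$ and the number $\mathcal{E}(\mathcal{A},m)$ of equivalence classes of Cayley graphs $C(\mathcal{A},\Omega)$ of degree $m$ satisfies $$\mathcal{E}(\mathcal{A},m)=\sum_{k=0}^{\lfloor m/2\rfloor}|G_{m,k}(\mathcal{A})/\mathrm{Inn}(\mathcal{A})|=\sum_{k=0}^{\lfloor m/2\rfloor}\frac{\sum_{(\alpha,\sigma,\tau)\in\mathrm{Inn}(\mathcal{A})\times\mathcal{K}_k}|F_{(\alpha,\sigma,\tau)}(m,k,\mathcal{A})|}{|\mathrm{Inn}(\mathcal{A})|\,k!\,(m-2k)!}.$$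
   Context: Let $\mathcal{A}$ be a finite group with identity $e$. For $\Omega\subseteq\mathcal{A}$ generating $\mathcal{A}$ with $\Omega=\Omega^{-1}$, $e\notin\Omega$, the Cayley graph $C(\mathcal{A},\Omega)$ has vertex set $\mathcal{A}$ and edges $\{g,h\}$ with $g^{-1}h\in\Omega$; it has degree $|\Omega|$. $\mathcal{A}$ acts by left multiplication. A graph isomorphism $f:C(\mathcal{A},\Omega)\to C(\mathcal{A},\Omega')$ is a weak equivalence if there is $\alpha\in\mathrm{Aut}(\mathcal{A})$ with $f(gu)=\alpha(g)f(u)$ for all $g,u$, and an equivalence if this holds with $\alpha=\mathrm{id}$. $\mathrm{Aut}(\mathcal{A})$ and $\mathrm{Inn}(\mathcal{A})$ denote the automorphism and inner automorphism groups. Let $G_m(\mathcal{A})=\{\Omega\subseteq\mathcal{A}:\Omega^{-1}=\Omega,\ \langle\Omega\rangle=\mathcal{A},\ |\Omega|=m,\ e\notin\Omega\}$. For $S\subseteq\mathcal{A}$ let $O_2(S)=\{g\in S: g^2=e, g\neq e\}$, and let $G_{m,k}(\mathcal{A})=\{\Omega\in G_m(\mathcal{A}): |O_2(\Omega)|=m-2k\}$. A subgroup $H\le\mathrm{Aut}(\mathcal{A})$ acts on $G_{m,k}(\mathcal{A})$ by $\alpha\cdot\Omega=\alpha(\Omega)$, and $G_{m,k}(\mathcal{A})/H$ denotes the orbit set. For $x\in\mathcal{A}$ let $\overline{x}=\{x,x^{-1}\}$. Let $\bar G_{m,k}(\mathcal{A})$ be the set of all $(m-k)$-tuples $(\overline{x_1},\dots,\overline{x_k},\overline{y_1},\dots,\overline{y_{m-2k}})$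 of pairwise distinct terms such that $x_i^2\neq e$ for all $i$, $y_j^{-1}=y_j\neq e$ for all $j$, and $\{x_1,\dots,x_k,y_1,\dots,y_{m-2k}\}$ generates $\mathcal{A}$. Let $S_k$ be the symmetric group on $k$ letters and $\mathcal{K}_k=S_k\times S_{m-2k}$. The group $\mathrm{Aut}(\mathcal{A})\times\mathcal{K}_k$ acts on $\bar G_{m,k}(\mathcal{A})$ by $(\alpha,\sigma,\tau)\cdot(\overline{x_1},\dots,\overline{x_k},\overline{y_1},\dots,\overline{y_{m-2k}})=(\overline{\alpha(x_{\sigma^{-1}(1)})},\dots,\overline{\alpha(x_{\sigma^{-1}(k)})},\overline{\alpha(y_{\tau^{-1}(1)})},\dots,\overline{\alpha(y_{\tau^{-1}(m-2k)})})$. For $(\alpha,\sigma,\tau)\in\mathrm{Aut}(\mathcal{A})\times\mathcal{K}_k$, $F_{(\alpha,\sigma,\tau)}(m,k,\mathcal{A})$ is the set of elements of $\bar G_{m,k}(\mathcal{A})$ fixed by $(\alpha,\sigma,\tau)$. *)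

(* Defs.v *)
From HB Require Import structures.
From mathcomp Require Import all_boot all_order all_algebra all_fingroup.

Set Implicit Arguments.
Unset Strict Implicit.
Unset Printing Implicit Defensive.

Import GroupScope.

Section CayleyGraphs.

Variable gT : finGroupType.
Implicit Types (O S : {set gT}) (a f : {perm gT}) (m k : nat).

(* For O = O^-1 with 1 \notin O this is a symmetric irreflexive adjacency
   relation on gT: see cayley_sym and cayley_irr. *)
Definition cayley O : rel gT := fun g h => g^-1 * h \in O.

Definition graph_iso f O O' : bool :=
  [forall u, forall v, cayley O u v == cayley O' (f u) (f v)].

Definition weak_equiv O O' : bool :=
  [exists f : {perm gT}, graph_iso f O O' &&
     [exists a in Aut [set: gT], forall g, forall u, f (g * u) == a g * f u]].

Definition equiv O O' : bool :=
  [exists f : {perm gT}, graph_iso f O O' &&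
     [forall g, forall u, f (g * u) == g * f u]].

Definition Inn : {set {perm gT}} := conj_aut [set: gT] @* [set: gT].

Definition Gm m : {set {set gT}} :=
  [set O : {set gT} | [&& O^-1 == O, <<O>> == [set: gT], #|O| == m & 1 \notin O]].

Definition O2 S : {set gT} := [set g in S | (g ^+ 2 == 1) && (g != 1)].

(* Only used for k <= m %/ 2, where the subtraction is exact. *)
Definition Gmk m k : {set {set gT}} :=
  [set O in Gm m | #|O2 O| == (m - 2 * k)%N].

(* C(gT, O) determines O, so classes of graphs of degree m are counted as
   classes of connection sets in Gm m: see weak_equiv_equivalence and
   equiv_equivalence for the side condition of equivalence_partition. *)
Definition num_weak_equiv m : nat := #|equivalence_partition weak_equiv (Gm m)|.
Definition num_equiv m : nat := #|equivalence_partition equiv (Gm m)|.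

(* 'P^* is the action of permutations on sets, O |-> a @: O. *)
Definition Gmk_orbits m k (H : {set {perm gT}}) : {set {set {set gT}}} :=
  orbit 'P^* H @: Gmk m k.

Definition bar (x : gT) : {set gT} := [set x; x^-1].

(* An (m - k)-tuple is split into its first k and its last m - 2k terms. *)
Definition bar_tuple m k : finType :=
  (k.-tuple {set gT} * (m - 2 * k).-tuple {set gT})%type.

Definition barG m k : {set bar_tuple m k} :=
  [set (map_tuple bar z.1, map_tuple bar z.2)
     | z : k.-tuple gT * (m - 2 * k).-tuple gT
     & [&& uniq (map bar z.1 ++ map bar z.2),
           all (fun x => x ^+ 2 != 1) z.1,
           all (fun y => (y^-1 == y) && (y != 1)) z.2
         & <<[set x in z.1 ++ z.2]>> == [set: gT]]].

Definition AutK m k : finType := ({perm gT} * ('S_k * 'S_(m - 2 * k)))%type.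

(* The bar of a x is written as the image a @: bar x: see imset_bar. *)
Definition bar_act m k (p : AutK m k) (t : bar_tuple m k) : bar_tuple m k :=
  let: (a, (s, r)) := p in
  ([tuple a @: tnth t.1 (s^-1 i) | i < k],
   [tuple a @: tnth t.2 (r^-1 j) | j < (m - 2 * k)%N]).

Definition Fix_barG m k (p : AutK m k) : {set bar_tuple m k} :=
  [set t in barG m k | bar_act p t == t].

Definition HK m k (H : {set {perm gT}}) : {set AutK m k} :=
  setX H [set: 'S_k * 'S_(m - 2 * k)].

Lemma cayley_sym O : O^-1 = O -> symmetric (cayley O).
Proof.
by move=> OV g h; rewrite /cayley -{1}OV inE invMg invgK.
Qed.

Lemma cayley_irr O : 1 \notin O -> irreflexive (cayley O).
Proof. by move=> O1 g; rewrite /cayley mulVg (negPf O1). Qed.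

Lemma cayley_inj O O' : cayley O =2 cayley O' -> O = O'.
Proof.
by move=> eqO; apply/setP=> x; move: (eqO 1 x); rewrite /cayley invg1 mul1g.
Qed.

Lemma cayley_degree O g : #|[set h | cayley O g h]| = #|O|.
Proof.
rewrite -[RHS](card_imset _ (mulgI g)); apply: eq_card => h; rewrite inE /cayley.
apply/idP/imsetP => [Oh | [x Ox ->]]; last by rewrite mulKg.
by exists (g^-1 * h) => //; rewrite mulKVg.
Qed.

Lemma weak_equivP O O' :
  reflect (exists f : {perm gT}, exists2 a, a \in Aut [set: gT] &
             (forall u v, cayley O u v = cayley O' (f u) (f v)) /\
             (forall g u, f (g * u) = a g * f u))
          (weak_equiv O O').
Proof.
apply: (iffP existsP) => [[f /andP[/forallP fi /existsP[a /andP[Aa /forallP fa]]]]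
                         | [f [a Aa [fi fa]]]].
  exists f, a => //; split=> [u v | g u]; apply/eqP.
  - by move: v; apply/forallP/fi.
  - by move: u; apply/forallP/fa.
exists f; apply/andP; split; first by apply/'forall_forallP => u v; rewrite fi.
by apply/existsP; exists a; rewrite Aa; apply/'forall_forallP => g u; rewrite fa.
Qed.

Lemma equivP O O' :
  reflect (exists f : {perm gT},
             (forall u v, cayley O u v = cayley O' (f u) (f v)) /\
             (forall g u, f (g * u) = g * f u))
          (equiv O O').
Proof.
apply: (iffP existsP) => [[f /andP[/forallP fi /forallP fa]] | [f [fi fa]]].
  exists f; split=> [u v | g u]; apply/eqP.
  - by move: v; apply/forallP/fi.
  - by move: u; apply/forallP/fa.
exists f; apply/andP; split; first by apply/'forall_forallP => u v; rewrite fi.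
by apply/'forall_forallP => g u; rewrite fa.
Qed.

Lemma weak_equiv_refl : reflexive weak_equiv.
Proof.
move=> O; apply/weak_equivP; exists 1, 1; first exact: group1.
by split=> *; rewrite !perm1.
Qed.

Lemma weak_equiv_sym : symmetric weak_equiv.
Proof.
suff sym O O' : weak_equiv O O' -> weak_equiv O' O.
  by move=> O O'; apply/idP/idP; apply: sym.
case/weak_equivP=> f [a Aa [fi fa]]; apply/weak_equivP.
exists f^-1, a^-1; first by rewrite groupV.
split=> [u v | g u]; first by rewrite fi !permKV.
by apply: (@perm_inj _ f); rewrite fa !permKV.
Qed.

Lemma weak_equiv_trans : transitive weak_equiv.
Proof.
move=> O2' O1 O3 /weak_equivP[f [a Aa [fi fa]]] /weak_equivP[g [b Ab [gi ga]]].
apply/weak_equivP; exists (f * g), (a * b); first exact: groupM.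
by split=> *; rewrite !permM ?fi ?gi ?fa ?ga.
Qed.

Lemma weak_equiv_equivalence : equivalence_rel weak_equiv.
Proof.
apply/equivalence_relP; split; first exact: weak_equiv_refl.
exact: (sym_left_transitive weak_equiv_sym weak_equiv_trans).
Qed.

Lemma equiv_refl : reflexive equiv.
Proof. by move=> O; apply/equivP; exists 1; split=> *; rewrite !perm1. Qed.

Lemma equiv_sym : symmetric equiv.
Proof.
suff sym O O' : equiv O O' -> equiv O' O.
  by move=> O O'; apply/idP/idP; apply: sym.
case/equivP=> f [fi fa]; apply/equivP; exists f^-1.
split=> [u v | g u]; first by rewrite fi !permKV.
by apply: (@perm_inj _ f); rewrite fa !permKV.
Qed.

Lemma equiv_trans : transitive equiv.
Proof.
move=> O2' O1 O3 /equivP[f [fi fa]] /equivP[g [gi ga]].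
apply/equivP; exists (f * g).
by split=> *; rewrite !permM ?fi ?gi ?fa ?ga.
Qed.

Lemma equiv_equivalence : equivalence_rel equiv.
Proof.
apply/equivalence_relP; split; first exact: equiv_refl.
exact: (sym_left_transitive equiv_sym equiv_trans).
Qed.

Lemma imset_bar a x : a \in Aut [set: gT] -> a @: bar x = bar (a x).
Proof.
move=> Aa; rewrite /bar imsetU1 imset_set1; congr [set _; _].
by rewrite -!(autmE Aa) morphV ?inE.
Qed.

Lemma InnP a :
  reflect (exists c, forall x, a x = x ^ c) (a \in Inn).
Proof.
apply: (iffP imsetP) => [[c _ ->] | [c ac]].
  by exists c => x; rewrite norm_conj_autE ?inE //; apply/subsetP=> ?; rewrite inE.
exists c; first by rewrite !inE andbT; apply/subsetP=> ?; rewrite inE.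
apply/permP=> x; rewrite ac norm_conj_autE ?inE //.
by apply/subsetP=> ?; rewrite inE.
Qed.

End CayleyGraphs.

(* Main.v *)
Require Import Defs.
From mathcomp Require Import all_boot all_order all_algebra all_fingroup.
From mathcomp Require Import zify.

(* A graph isomorphism f with f (g u) = a(g) f(u) is u |-> a(u) c with c = f 1,
   and it carries C(A, O) to C(A, O') exactly when O' = a(O)^c.  So the weak
   equivalence (resp. equivalence) classes of connection sets are the orbits of
   Aut A (resp. Inn A) on G_m, and G_m is the disjoint union of the invariant
   pieces G_{m,k}, because the elements of O that are not involutions come in
   pairs {x, x^-1}.  Sending a tuple of bars to the union of its terms maps the
   tuples onto G_{m,k}; its fibres are the orbits of S_k x S_{m-2k} and it is
   Aut A-equivariant, so H-orbits on G_{m,k} correspond to orbits of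
   H x S_k x S_{m-2k} on tuples, which the Cauchy-Frobenius lemma counts. *)

Set Implicit Arguments.
Unset Strict Implicit.
Unset Printing Implicit Defensive.

Import GroupScope GRing.Theory Num.Theory.

Lemma card_imset_eq_kernel (aT rT rT' : finType) (f : aT -> rT) (g : aT -> rT')
    (D : {set aT}) :
    {in D &, forall x y, (f x == f y) = (g x == g y)} ->
  #|f @: D| = #|g @: D|.
Proof.
move=> fg_ker; pose fg x := (f x, g x).
have -> : f @: D = fst @: (fg @: D) by rewrite -imset_comp.
have -> : g @: D = snd @: (fg @: D) by rewrite -imset_comp.
have fst_inj : {in fg @: D &, injective fst}.
  move=> _ _ /imsetP[x Dx ->] /imsetP[y Dy ->] /= /[dup] fxy /eqP.
  by rewrite fg_ker // /fg fxy => /eqP->.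
have snd_inj : {in fg @: D &, injective snd}.
  move=> _ _ /imsetP[x Dx ->] /imsetP[y Dy ->] /= /[dup] gxy /eqP.
  by rewrite -fg_ker // /fg gxy => /eqP->.
by rewrite (card_in_imset fst_inj) (card_in_imset snd_inj).
Qed.

Lemma imset_set_seq (aT rT : finType) (f : aT -> rT) (s : seq aT) :
  f @: [set x in s] = [set y in map f s].
Proof.
apply/setP=> y; rewrite inE; apply/imsetP/mapP => -[x].
  by rewrite inE; exists x.
by exists x; rewrite ?inE.
Qed.

Lemma all_imset_tupleP (aT rT : finType) (f : aT -> rT) (D : {set aT})
    n (t : n.-tuple rT) :
  reflect (exists2 z : n.-tuple aT, all [in D] z & t = map_tuple f z)
          (all [in f @: D] t).
Proof.
apply: (iffP all_tnthP) => [t_im | [z /all_tnthP zD ->] i]; last first.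
  by rewrite tnth_map; apply/imset_f/zD.
have /fin_all_exists2[z zD tE]: forall i, exists2 x, x \in D & tnth t i = f x.
  by move=> i; apply/imsetP/t_im.
exists [tuple z i | i < n].
  by apply/all_tnthP=> i; rewrite tnth_mktuple zD.
by apply: eq_from_tnth => i; rewrite tnth_map tnth_mktuple tE.
Qed.

Lemma perm_map_tupleP (T T' : eqType) (f : T -> T') n
    (t : n.-tuple T) (t' : n.-tuple T') :
  reflect (exists s : 'S_n, t' = [tuple f (tnth t (s i)) | i < n])
          (perm_eq t' (map f t)).
Proof.
have tuple_mapE (s : 'S_n) : [tuple f (tnth t (s i)) | i < n]
    = [tuple tnth (map_tuple f t) (s i) | i < n].
  by apply: eq_from_tnth => i; rewrite !tnth_mktuple tnth_map.
apply: (iffP (tuple_permP (t := map_tuple f t))) => -[s t'E]; exists s.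
  by rewrite tuple_mapE; apply: val_inj.
by rewrite t'E tuple_mapE.
Qed.

Section Orbits.

Variables (aT : finGroupType) (rT : finType) (to : {action aT &-> rT}).
Variable G : {group aT}.

Lemma equivalence_partition_orbits (R : rel rT) (S : {set rT}) :
    [acts G, on S | to] -> (forall x y, R x y = (y \in orbit to G x)) ->
  equivalence_partition R S = orbit to G @: S.
Proof.
move=> actsS RE; apply: eq_in_imset => x Sx; apply/setP=> y.
rewrite inE RE andb_idl // => /orbitP[a Ga <-].
by rewrite (actsP actsS).
Qed.

Lemma card_orbits_bigcup (I : finType) (S : I -> {set rT}) :
    (forall i, [acts G, on S i | to]) ->
    (forall i j, i != j -> [disjoint S i & S j]) ->
  #|orbit to G @: (\bigcup_i S i)| = (\sum_i #|orbit to G @: S i|)%N.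
Proof.
move=> actsS dS.
have -> : orbit to G @: (\bigcup_i S i) = \bigcup_i (orbit to G @: S i).
  apply/setP=> X; apply/imsetP/bigcupP => [[x /bigcupP[i _ Sx] ->]|].
    by exists i => //; apply: imset_f.
  by case=> i _ /imsetP[x Sx ->]; exists x => //; apply/bigcupP; exists i.
rewrite -sum1_card partition_disjoint_bigcup => [|i j ij].
  by apply: eq_bigr => i _; rewrite sum1_card.
apply/pred0P=> X; apply/negP=> /andP[/= /imsetP[x Sx ->] /imsetP[y Sy]].
move/orbit_eqP=> /orbitP[a Ga yx].
have /pred0P/(_ x) := dS i j ij.
by rewrite /= Sx -yx (actsP (actsS j)) ?Sy.
Qed.

Lemma card_orbits_equivariant (aT' : finGroupType) (rT' : finType)
    (to' : {action aT' &-> rT'}) (G' : {group aT'}) (S : {set rT})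
    (f : rT -> rT') :
    {in S &, forall x y,
      (x \in orbit to G y) = (f x \in orbit to' G' (f y))} ->
  #|orbit to G @: S| = #|orbit to' G' @: (f @: S)|.
Proof.
move=> f_orb; rewrite -imset_comp; apply: card_imset_eq_kernel => x y Sx Sy /=.
apply/eqP/eqP => /orbit_eqP; first by rewrite f_orb // => /orbit_eqP.
by rewrite -f_orb // => /orbit_eqP.
Qed.

End Orbits.

Section Bars.

Variable gT : finGroupType.
Implicit Types (x y : gT) (S : {set gT}).

Lemma sqg_eq1 x : (x ^+ 2 == 1) = (x^-1 == x).
Proof. by rewrite expgS expg1 -eq_invg_mul. Qed.

Lemma bar_id x : x \in bar x. Proof. exact: set21. Qed.

Lemma barV x : bar x^-1 = bar x. Proof. by rewrite /bar invgK setUC. Qed.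

Lemma mem_bar x y : (y \in bar x) = (bar y == bar x).
Proof.
apply/idP/eqP => [/set2P[] -> // | <-]; [exact: barV | exact: bar_id].
Qed.

Lemma card_bar x : #|bar x| = (x ^+ 2 != 1).+1.
Proof. by rewrite cards2 sqg_eq1 eq_sym. Qed.

Lemma bar_sub S x : S^-1 = S -> (bar x \subset S) = (x \in S).
Proof. by move=> SV; rewrite subUset !sub1set -{2}SV inE invgK andbb. Qed.

Lemma mem_imset_bar S x : S^-1 = S -> (bar x \in @bar gT @: S) = (x \in S).
Proof.
move=> SV; apply/imsetP/idP => [[y Sy xy] | Sx]; last by exists x.
by rewrite -bar_sub // xy bar_sub.
Qed.

Lemma partition_bars S : S^-1 = S -> partition (@bar gT @: S) S.
Proof.
move=> SV; have -> : @bar gT @: S = preim_partition (@bar gT) S.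
  apply: eq_in_imset => x Sx; apply/setP=> y; rewrite inE eq_sym -mem_bar.
  by rewrite andb_idl //; apply/subsetP; rewrite bar_sub.
exact: preim_partitionP.
Qed.

Lemma mem_cover_bars (P : {set {set gT}}) x :
  P \subset @bar gT @: [set: gT] -> (x \in cover P) = (bar x \in P).
Proof.
move/subsetP=> P_bars; apply/bigcupP/idP => [[B PB] | Px].
  case/imsetP: (P_bars B PB) => y _ EB.
  by rewrite EB mem_bar => /eqP->; rewrite -EB.
by exists (bar x); rewrite ?bar_id.
Qed.

Lemma eq_mem_bars_setI (T T' : {pred {set gT}}) (D D' U : {set gT}) :
    {subset T <= @bar gT @: D} -> {subset T' <= @bar gT @: D'} ->
    D'^-1 = D' -> [disjoint D & D'] ->
    (forall x, (x \in U) = (bar x \in T) || (bar x \in T')) ->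
  T =i @bar gT @: (U :&: D).
Proof.
move=> TD T'D' D'V dD UE B; apply/idP/imsetP => [TB | [x]].
  have /imsetP[x Dx EB] := TD B TB.
  by exists x; rewrite // inE Dx UE -EB TB.
rewrite inE UE => /andP[/orP[Tx | /T'D' D'x] Dx -> //].
by move: D'x; rewrite mem_imset_bar // (disjointFr dD Dx).
Qed.

Lemma gen_cover_bars S : <<cover (@bar gT @: S)>> = <<S>>.
Proof.
apply/eqP; rewrite cover_imset eqEsubset !gen_subG; apply/andP; split.
  apply/bigcupsP=> x Sx; rewrite subUset !sub1set groupV andbb.
  exact: mem_gen.
apply/subsetP=> x Sx; apply/mem_gen/bigcupP.
by exists x; rewrite ?bar_id.
Qed.

Definition non_involutions S := [set g in S | g ^+ 2 != 1].

Lemma non_involutionsV S :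
  S^-1 = S -> (non_involutions S)^-1 = non_involutions S.
Proof.
by move=> SV; apply/setP=> x; rewrite !inE -{2}SV inE expgVn invg_eq1.
Qed.

Lemma O2V S : S^-1 = S -> (O2 S)^-1 = O2 S.
Proof.
by move=> SV; apply/setP=> x; rewrite !inE -{2}SV inE expgVn !invg_eq1.
Qed.

Lemma non_involutionsU_O2 S : 1 \notin S -> non_involutions S :|: O2 S = S.
Proof.
move=> S1; apply/setP=> x; rewrite !inE -andb_orr.
have [->|_] := eqVneq x 1; first by rewrite (negPf S1).
by rewrite andbT orNb andbT.
Qed.

Lemma disjoint_O2_non_involutions S : [disjoint O2 S & non_involutions S].
Proof.
by apply/pred0P=> x; rewrite /= !inE; case: (x ^+ 2 == 1); rewrite ?andbF.
Qed.

Lemma card_non_involutions S : S^-1 = S ->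
  #|non_involutions S| = (#|@bar gT @: non_involutions S| * 2)%N.
Proof.
move=> /non_involutionsV/partition_bars; apply: card_uniform_partition.
by move=> _ /imsetP[x + ->]; rewrite inE card_bar => /andP[_ ->].
Qed.

Lemma card_O2 S : S^-1 = S -> #|O2 S| = #|@bar gT @: O2 S|.
Proof.
move=> /O2V/partition_bars; rewrite -[RHS]muln1; apply: card_uniform_partition.
by move=> _ /imsetP[x + ->]; rewrite inE card_bar => /and3P[_ -> _].
Qed.

Lemma card_inv_closedE S : S^-1 = S -> 1 \notin S ->
  #|S| = (2 * #|@bar gT @: non_involutions S| + #|O2 S|)%N.
Proof.
move=> SV S1; rewrite -{1}(non_involutionsU_O2 S1) cardsU.
rewrite setIC (disjoint_setI0 (disjoint_O2_non_involutions S)) cards0 subn0.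
by rewrite card_non_involutions // mulnC.
Qed.

End Bars.

Section BarTuples.

Variables (gT : finGroupType) (m k : nat).
Implicit Types (t : bar_tuple gT m k) (x : gT) (O : {set gT}).

Definition bars_union t : {set gT} := cover [set B in t.1 ++ t.2].

Lemma GmkP O :
  reflect [/\ O^-1 = O, <<O>> = [set: gT], #|O| = m, 1 \notin O
            & #|O2 O| = (m - 2 * k)%N]
          (O \in Gmk gT m k).
Proof.
rewrite !inE; apply: (iffP andP).
  by case=> /and4P[/eqP-> /eqP-> /eqP-> ->] /eqP->.
by case=> -> -> -> -> ->; rewrite !eqxx.
Qed.

Lemma bars_union_map (z1 : k.-tuple gT) (z2 : (m - 2 * k).-tuple gT) :
  bars_union (map_tuple (@bar gT) z1, map_tuple (@bar gT) z2)
    = cover (@bar gT @: [set x in z1 ++ z2]).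
Proof. by rewrite /bars_union /= -map_cat imset_set_seq. Qed.

Lemma in_barG t :
  (t \in barG gT m k) =
    [&& uniq t.1, uniq t.2, all [in @bar gT @: non_involutions [set: gT]] t.1,
        all [in @bar gT @: O2 [set: gT]] t.2 & <<bars_union t>> == [set: gT]].
Proof.
have in_O2T y : (y \in O2 [set: gT]) = (y^-1 == y) && (y != 1).
  by rewrite !inE /= sqg_eq1.
apply/imsetP/and5P => [[[z1 z2]] | [u1 u2]].
  rewrite inE /= cat_uniq => /and4P[/and3P[u1 _ u2] z1P z2P genz] ->.
  rewrite bars_union_map gen_cover_bars; split=> //.
    apply/all_imset_tupleP; exists z1 => //.
    by apply: sub_all z1P => x; rewrite !inE.
  apply/all_imset_tupleP; exists z2 => //.
  by apply: sub_all z2P => y; rewrite in_O2T.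
move=> /all_imset_tupleP[z1 z1P t1E] /all_imset_tupleP[z2 z2P t2E].
have tE : t = (map_tuple (@bar gT) z1, map_tuple (@bar gT) z2).
  by rewrite -t1E -t2E; case: (t).
rewrite tE bars_union_map gen_cover_bars => genz; exists (z1, z2) => //.
rewrite inE /= genz cat_uniq; apply/and4P; split=> //.
- move: u1 u2; rewrite t1E t2E /= => -> ->; rewrite andbT.
  apply/hasPn=> _ /mapP[y z2y ->]; apply/negP=> /mapP[x z1x xy].
  move/allP/(_ y z2y): z2P; move/allP/(_ x z1x): z1P; rewrite !inE /= => x2.
  by have := card_bar y; rewrite xy card_bar x2; case: eqP.
- by apply: sub_all z1P => x; rewrite !inE.
- by apply: sub_all z2P => y; rewrite in_O2T.
Qed.

Lemma barG_bars t : t \in barG gT m k ->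
  [set B in t.1 ++ t.2] \subset @bar gT @: [set: gT].
Proof.
rewrite in_barG => /and5P[_ _ /allP t1 /allP t2 _].
apply/subsetP=> B; rewrite inE mem_cat => /orP[/t1|/t2];
  by apply/subsetP/imsetS/subsetT.
Qed.

Lemma mem_bars_union t x : t \in barG gT m k ->
  (x \in bars_union t) = (bar x \in t.1) || (bar x \in t.2).
Proof. by move=> Gt; rewrite mem_cover_bars ?barG_bars // inE mem_cat. Qed.

Lemma bars_unionV t : t \in barG gT m k -> (bars_union t)^-1 = bars_union t.
Proof. by move=> Gt; apply/setP=> x; rewrite inE !mem_bars_union // barV. Qed.

Lemma mem_barG_fst t : t \in barG gT m k ->
  t.1 =i @bar gT @: non_involutions (bars_union t).
Proof.
move=> Gt; have:= Gt; rewrite in_barG => /and5P[_ _ /allP t1 /allP t2 _].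
have -> : non_involutions (bars_union t)
    = bars_union t :&: non_involutions [set: gT].
  by apply/setP=> x; rewrite !inE.
apply: eq_mem_bars_setI t1 t2 _ _ _ => [||x].
- by rewrite O2V ?invGid.
- by rewrite disjoint_sym disjoint_O2_non_involutions.
- exact: mem_bars_union.
Qed.

Lemma mem_barG_snd t : t \in barG gT m k -> t.2 =i @bar gT @: O2 (bars_union t).
Proof.
move=> Gt; have:= Gt; rewrite in_barG => /and5P[_ _ /allP t1 /allP t2 _].
have -> : O2 (bars_union t) = bars_union t :&: O2 [set: gT].
  by apply/setP=> x; rewrite !inE.
apply: eq_mem_bars_setI t2 t1 _ _ _ => [||x].
- by rewrite non_involutionsV ?invGid.
- exact: disjoint_O2_non_involutions.
- by rewrite mem_bars_union // orbC.
Qed.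

Hypothesis le_km : 2 * k <= m.

Lemma bars_union_Gmk t : t \in barG gT m k -> bars_union t \in Gmk gT m k.
Proof.
move=> Gt; have OV := bars_unionV Gt; have:= Gt.
rewrite in_barG => /and5P[u1 u2 _ _ /eqP gent].
have O1 : 1 \notin bars_union t.
  rewrite mem_bars_union // mem_barG_fst // mem_barG_snd //.
  rewrite !mem_imset_bar ?O2V ?non_involutionsV // !inE expg1n eqxx.
  by rewrite !andbF.
have cardO2 : #|O2 (bars_union t)| = (m - 2 * k)%N.
  by rewrite card_O2 // -(eq_card (mem_barG_snd Gt)) (card_uniqP u2) size_tuple.
apply/GmkP; split=> //; rewrite card_inv_closedE // cardO2.
by rewrite -(eq_card (mem_barG_fst Gt)) (card_uniqP u1) size_tuple subnKC.
Qed.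

Lemma bars_union_barG : bars_union @: barG gT m k = Gmk gT m k.
Proof.
apply/setP=> O; apply/imsetP/idP => [[t Gt ->] | GO].
  exact: bars_union_Gmk.
have /GmkP[OV genO cardO O1 cardO2] := GO.
have size1 : size (enum (@bar gT @: non_involutions O)) == k.
  by rewrite -cardE; apply/eqP; move: (card_inv_closedE OV O1) le_km; lia.
have size2 : size (enum (@bar gT @: O2 O)) == (m - 2 * k)%N.
  by rewrite -cardE -card_O2 // cardO2.
pose t : bar_tuple gT m k := (Tuple size1, Tuple size2).
have tO : bars_union t = O.
  rewrite -[RHS](cover_partition (partition_bars OV)); congr cover.
  rewrite -{1}(non_involutionsU_O2 O1) imsetU; apply/setP=> B.
  by rewrite inE mem_cat !mem_enum in_setU.
exists t => //; rewrite in_barG tO genO !enum_uniq eqxx andbT /=.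
apply/andP; split; apply/allP=> B; rewrite mem_enum /=;
  by apply/subsetP/imsetS/subsetP=> x; rewrite !inE => /andP[_ ->].
Qed.

End BarTuples.

Section Automorphisms.

Variable gT : finGroupType.
Implicit Types (x y : gT) (O S : {set gT}) (a : {perm gT}).

Lemma Aut_setTM a x y : a \in Aut [set: gT] -> a (x * y) = a x * a y.
Proof. by move=> Aa; rewrite -!(autmE Aa) morphM ?inE. Qed.

Lemma Aut_setTV a x : a \in Aut [set: gT] -> a x^-1 = (a x)^-1.
Proof. by move=> Aa; rewrite -!(autmE Aa) morphV ?inE. Qed.

Lemma Aut_setT_eq1 a x : a \in Aut [set: gT] -> (a x == 1) = (x == 1).
Proof.
move=> Aa; have a1 : a 1 = 1 by rewrite -(autmE Aa) morph1.
by rewrite -{1}a1 (inj_eq perm_inj).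
Qed.

Lemma Aut_setT_sqg_eq1 a x : a \in Aut [set: gT] ->
  (a x ^+ 2 == 1) = (x ^+ 2 == 1).
Proof. by move=> Aa; rewrite !sqg_eq1 -Aut_setTV // (inj_eq perm_inj). Qed.

Lemma Aut_imset_morphim a S (Aa : a \in Aut [set: gT]) :
  a @: S = autm Aa @* S.
Proof. by rewrite morphimEsub ?subsetT // autmE. Qed.

Lemma imset_perm_inj a : injective (fun S => a @: S).
Proof. exact/imset_inj/perm_inj. Qed.

Lemma imset_Aut_setT a : a \in Aut [set: gT] -> a @: [set: gT] = [set: gT].
Proof. by move=> Aa; rewrite (Aut_imset_morphim _ Aa) im_autm. Qed.

Lemma imset_Aut_gen a S : a \in Aut [set: gT] -> a @: <<S>> = <<a @: S>>.
Proof.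
by move=> Aa; rewrite !(Aut_imset_morphim _ Aa) morphim_gen ?subsetT.
Qed.

Lemma imset_AutV a S : a \in Aut [set: gT] -> a @: S^-1 = (a @: S)^-1.
Proof. by move=> Aa; rewrite !(Aut_imset_morphim _ Aa) morphimV. Qed.

Lemma bars_Aut a S : a \in Aut [set: gT] ->
  @bar gT @: (a @: S) = (fun B : {set gT} => a @: B) @: (@bar gT @: S).
Proof.
by move=> Aa; rewrite -!imset_comp; apply: eq_imset => x /=; rewrite imset_bar.
Qed.

Lemma non_involutions_Aut a S : a \in Aut [set: gT] ->
  non_involutions (a @: S) = a @: non_involutions S.
Proof.
move=> Aa; apply/setP=> y; rewrite -[y](permKV a) inE !(mem_imset _ _ perm_inj).
by rewrite inE Aut_setT_sqg_eq1.
Qed.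

Lemma O2_Aut a S : a \in Aut [set: gT] -> O2 (a @: S) = a @: O2 S.
Proof.
move=> Aa; apply/setP=> y; rewrite -[y](permKV a) inE !(mem_imset _ _ perm_inj).
by rewrite inE Aut_setT_sqg_eq1 // Aut_setT_eq1.
Qed.

Lemma setact_permE a S : ('P^*)%act S a = a @: S.
Proof. by []. Qed.

Lemma acts_Gm m : [acts Aut [set: gT], on Gm gT m | 'P^*].
Proof.
apply/subsetP=> a Aa; rewrite !inE; apply/subsetP=> O.
rewrite !inE => /and4P[/eqP OV /eqP genO /eqP cardO O1].
rewrite setact_permE -imset_AutV // OV -imset_Aut_gen // genO imset_Aut_setT //.
rewrite card_imset ?cardO ?eqxx /=; last exact: perm_inj.
apply: contra O1 => /imsetP[x Ox /esym/eqP].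
by rewrite Aut_setT_eq1 // => /eqP<-.
Qed.

Lemma acts_Gmk m k : [acts Aut [set: gT], on Gmk gT m k | 'P^*].
Proof.
apply/subsetP=> a Aa; rewrite !inE; apply/subsetP=> O.
case/setIdP=> GO cardO2; rewrite inE [_ \in Gmk _ _ _]inE.
rewrite (actsP (acts_Gm m)) // GO setact_permE O2_Aut // card_imset //.
exact: perm_inj.
Qed.

Lemma orbit_perm_imsetP (A : {set {perm gT}}) O O' :
  reflect (exists2 a, a \in A & O' = a @: O) (O' \in orbit 'P^* A O).
Proof. by apply: (iffP imsetP). Qed.

End Automorphisms.

Section BarAction.

Variables (gT : finGroupType) (m k : nat).
Implicit Types (t : bar_tuple gT m k) (a : {perm gT}).

(* bar_act with AutK recast as a group type and the arguments in the order of an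
   action; permutations compose left to right, so this is a right action. *)
Definition bar_op t (p : ({perm gT} * ('S_k * 'S_(m - 2 * k)))%type) :=
  bar_act p t.

Lemma bar_op1 : bar_op^~ 1 =1 id.
Proof.
case=> t1 t2; rewrite /bar_op /=; congr (_, _); apply: eq_from_tnth => i;
  by rewrite tnth_mktuple invg1 perm1 (eq_imset _ (@perm1 _)) imset_id.
Qed.

Lemma bar_opM t : act_morph bar_op t.
Proof.
case=> [a [s r]] [b [s' r']]; rewrite /bar_op /=.
congr (_, _); apply: eq_from_tnth => i; rewrite !tnth_mktuple invMg permM;
  by rewrite -imset_comp; apply: eq_imset => x; rewrite permM.
Qed.

Canonical bar_action := TotalAction bar_op1 bar_opM.

Lemma bar_opP a t t' :
  reflect (exists sr, bar_op t (a, sr) = t')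
          (perm_eq t'.1 (map (fun B : {set gT} => a @: B) t.1) &&
           perm_eq t'.2 (map (fun B : {set gT} => a @: B) t.2)).
Proof.
apply: (iffP andP) => [[/perm_map_tupleP[s t1E] /perm_map_tupleP[r t2E]] |].
  exists (s^-1, r^-1); rewrite /bar_op /= !invgK.
  by case: t' t1E t2E => /= _ _ -> ->.
case=> -[s r] <-; split; apply/perm_map_tupleP; first by exists s^-1.
by exists r^-1.
Qed.

Lemma perm_eq_bar_op t a sr :
  perm_eq (bar_op t (a, sr)).1 (map (fun B : {set gT} => a @: B) t.1) &&
  perm_eq (bar_op t (a, sr)).2 (map (fun B : {set gT} => a @: B) t.2).
Proof. by apply/bar_opP; exists sr. Qed.

Lemma bars_union_bar_op t p : bars_union (bar_op t p) = p.1 @: bars_union t.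
Proof.
case: p => a sr.
have /andP[pe1 pe2] := perm_eq_bar_op t a sr.
rewrite /bars_union imset_cover -cover_imset imset_set_seq map_cat.
congr cover; apply/setP=> B.
by rewrite !inE !mem_cat (perm_mem pe1) (perm_mem pe2).
Qed.

Lemma bar_op_barG t a sr : a \in Aut [set: gT] ->
  t \in barG gT m k -> bar_op t (a, sr) \in barG gT m k.
Proof.
move=> Aa; rewrite !in_barG bars_union_bar_op /=.
have /andP[pe1 pe2] := perm_eq_bar_op t a sr.
rewrite (perm_uniq pe1) (perm_uniq pe2) (perm_all _ pe1) (perm_all _ pe2).
rewrite !(map_inj_uniq (@imset_perm_inj _ a)) !all_map.
case/and5P=> -> -> t1 t2 /eqP gent.
rewrite -imset_Aut_gen // gent imset_Aut_setT // eqxx andbT /=.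
rewrite -(imset_Aut_setT Aa) non_involutions_Aut // O2_Aut // !bars_Aut //.
apply/andP; split; [apply: sub_all t1 | apply: sub_all t2] => B;
  by rewrite /= (mem_imset _ _ (@imset_perm_inj _ a)).
Qed.

Lemma eq_bars_union_perm_eq t t' : t \in barG gT m k -> t' \in barG gT m k ->
  bars_union t = bars_union t' -> perm_eq t.1 t'.1 && perm_eq t.2 t'.2.
Proof.
move=> Gt Gt' eq_union.
have:= Gt'; have:= Gt.
rewrite !in_barG => /and5P[u1 u2 _ _ _] /and5P[u1' u2' _ _ _].
apply/andP; split; apply: uniq_perm => // B.
  by rewrite !mem_barG_fst // eq_union.
by rewrite !mem_barG_snd // eq_union.
Qed.

Variable H : {group {perm gT}}.
Hypothesis sHA : H \subset Aut [set: gT].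

Lemma acts_barG :
  [acts setX H [set: 'S_k * 'S_(m - 2 * k)], on barG gT m k | bar_action].
Proof.
apply/subsetP=> -[a sr] /setXP[/(subsetP sHA) Aa _]; rewrite !inE.
by apply/subsetP=> t Gt; rewrite inE; apply: bar_op_barG.
Qed.

Lemma orbit_barG : {in barG gT m k &, forall t t',
  (t \in orbit bar_action (setX H [set: 'S_k * 'S_(m - 2 * k)]) t')
    = (bars_union t \in orbit 'P^* H (bars_union t'))}.
Proof.
move=> t t' Gt Gt'; apply/orbitP/orbit_perm_imsetP => [[[a sr]] | [a Ha tE]].
  by rewrite !inE andbT => Ha <-; exists a; rewrite ?bars_union_bar_op.
have Gat' : bar_op t' (a, 1) \in barG gT m k.
  by rewrite (actsP acts_barG) // !inE Ha.
have /andP[pe1 pe2] := perm_eq_bar_op t' a 1.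
have /bar_opP[sr t'E]: perm_eq t.1 (map (fun B : {set gT} => a @: B) t'.1) &&
    perm_eq t.2 (map (fun B : {set gT} => a @: B) t'.2).
  rewrite -(permPr pe1) -(permPr pe2).
  by apply: eq_bars_union_perm_eq; rewrite // tE bars_union_bar_op.
by exists (a, sr); rewrite // !inE Ha.
Qed.

Hypothesis le_km : 2 * k <= m.

Lemma sum_Fix_barG :
  (\sum_(p in HK m k H) #|Fix_barG p| =
   #|Gmk_orbits m k H| * (#|H| * k`! * (m - 2 * k)`!))%N.
Proof.
have -> : #|Gmk_orbits m k H|
    = #|orbit bar_action (setX H [set: 'S_k * 'S_(m - 2 * k)]) @: barG gT m k|.
  by rewrite (card_orbits_equivariant orbit_barG) bars_union_barG.
rewrite -mulnA -!card_Sn -card_prod -cardsT -cardsX.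
rewrite -(Frobenius_Cauchy acts_barG).
by apply: eq_bigr => p _; apply: eq_card => t; rewrite !inE sub1set inE.
Qed.

End BarAction.

Section ConnectionSets.

Variables (gT : finGroupType) (m : nat).

Lemma Gm_bigcup : Gm gT m = \bigcup_(k < (m %/ 2).+1) Gmk gT m k.
Proof.
apply/setP=> O; apply/idP/bigcupP => [GO | [k _]]; last by case/setIdP.
have:= GO; rewrite inE => /and4P[/eqP OV _ /eqP cardO O1].
have := card_inv_closedE OV O1; rewrite cardO; set k := #|_ @: _| => mE.
have lt_k : k < (m %/ 2).+1 by lia.
exists (Ordinal lt_k) => //; rewrite inE GO; apply/eqP.
by rewrite -[nat_of_ord _]/k; lia.
Qed.

Lemma Gmk_disjoint (i j : 'I_(m %/ 2).+1) :
  i != j -> [disjoint Gmk gT m i & Gmk gT m j].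
Proof.
apply: contraNT => /pred0Pn[O /andP[/GmkP[_ _ _ _ Oi] /GmkP[_ _ _ _ Oj]]].
by apply/eqP/val_inj => /=; move: (ltn_ord i) (ltn_ord j); lia.
Qed.

Variable H : {group {perm gT}}.
Hypothesis sHA : H \subset Aut [set: gT].

Lemma card_orbits_Gm :
  #|orbit 'P^* H @: Gm gT m|
    = (\sum_(0 <= k < (m %/ 2).+1) #|Gmk_orbits m k H|)%N.
Proof.
rewrite Gm_bigcup card_orbits_bigcup ?big_mkord //; last exact: Gmk_disjoint.
by move=> k; apply: subset_trans sHA (acts_Gmk _ _ _).
Qed.

Lemma card_orbits_Gm_Fix :
  (#|orbit 'P^* H @: Gm gT m|%:R = \sum_(0 <= k < (m %/ 2).+1)
    (\sum_(p in HK m k H) #|Fix_barG p|%:R)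
      / (#|H| * k`! * (m - 2 * k)`!)%:R :> rat)%R.
Proof.
rewrite card_orbits_Gm natr_sum; apply: eq_big_nat => k /andP[_ lt_k].
have le_km : 2 * k <= m by lia.
rewrite -natr_sum sum_Fix_barG // natrM mulfK //.
by rewrite pnatr_eq0 -lt0n !muln_gt0 cardG_gt0 !fact_gt0.
Qed.

End ConnectionSets.

Section Equivalences.

Variable gT : finGroupType.
Implicit Types (O : {set gT}) (a b f : {perm gT}).

Canonical Inn_group := Eval hnf in [group of Inn gT].

Lemma Inn_sub_Aut : Inn gT \subset Aut [set: gT].
Proof. exact: Aut_conj_aut. Qed.

Lemma eq_imset_perm b O O' :
  O' = b @: O <-> forall x, (x \in O) = (b x \in O').
Proof.
split=> [-> x | bO]; first by rewrite (mem_imset _ _ perm_inj).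
by apply/setP=> y; rewrite -[y](permKV b) (mem_imset _ _ perm_inj) bO.
Qed.

Lemma cayley_iso_imset a b f c O O' :
    a \in Aut [set: gT] -> (forall u, f u = a u * c) ->
    (forall x, b x = a x ^ c) ->
  (forall u v, cayley O u v = cayley O' (f u) (f v)) <-> O' = b @: O.
Proof.
move=> Aa fE bE; rewrite eq_imset_perm.
have O'E u v : cayley O' (f u) (f v) = (b (u^-1 * v) \in O').
  by rewrite /cayley !fE bE Aut_setTM // Aut_setTV // conjgE invMg !mulgA.
split=> [f_iso x | bO u v]; last by rewrite O'E -bO.
by have := f_iso 1 x; rewrite O'E /cayley invg1 mul1g.
Qed.

Lemma cayley_iso_orbitP (A : {set {perm gT}}) O O' : A \subset Aut [set: gT] ->
  reflect (exists f : {perm gT}, exists2 a, a \in A &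
             (forall u v, cayley O u v = cayley O' (f u) (f v)) /\
             (forall g u, f (g * u) = a g * f u))
          (O' \in orbit 'P^* (A * Inn gT) O).
Proof.
move=> /subsetP sA; apply: (iffP (orbit_perm_imsetP _ _ _)).
  case=> _ /mulsgP[a i Aa /InnP[c iE] ->] O'E.
  pose f : {perm gT} := a * perm (mulIg c).
  have fE u : f u = a u * c by rewrite permM permE.
  exists f, a => //; split=> [|g u]; last by rewrite !fE Aut_setTM ?sA // mulgA.
  by apply: (cayley_iso_imset _ _ (sA a Aa) fE _).2 O'E => x; rewrite permM iE.
case=> f [a Aa [f_iso f_twist]].
have fE u : f u = a u * f 1 by rewrite -f_twist mulg1.
have [i iE] : exists i : {perm gT}, forall x, i x = x ^ f 1.
  by exists (perm (conjg_inj (f 1))) => x; rewrite permE.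
exists (a * i); first by apply: mem_mulg => //; apply/InnP; exists (f 1).
by apply: (cayley_iso_imset _ _ (sA a Aa) fE _).1 f_iso => x; rewrite permM iE.
Qed.

Lemma weak_equivE O O' :
  weak_equiv O O' = (O' \in orbit 'P^* (Aut [set: gT]) O).
Proof.
rewrite -[Aut _](mulGSid Inn_sub_Aut).
exact/weak_equivP/cayley_iso_orbitP.
Qed.

Lemma equivE O O' : Defs.equiv O O' = (O' \in orbit 'P^* (Inn gT) O).
Proof.
rewrite -[Inn gT]mul1g; apply/Defs.equivP/cayley_iso_orbitP; rewrite ?sub1G //.
  case=> f [f_iso f_equi]; exists f, 1; rewrite ?group1 //.
  by split=> // g u; rewrite perm1.
case=> f [_ /set1P-> [f_iso f_twist]]; exists f; split=> // g u.
by rewrite f_twist perm1.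
Qed.

Lemma num_weak_equivE m :
  num_weak_equiv gT m = #|orbit 'P^* (Aut [set: gT]) @: Gm gT m|.
Proof.
congr #|pred_of_set _|; apply: equivalence_partition_orbits weak_equivE.
exact: acts_Gm.
Qed.

Lemma num_equivE m : num_equiv gT m = #|orbit 'P^* (Inn gT) @: Gm gT m|.
Proof.
congr #|pred_of_set _|; apply: equivalence_partition_orbits equivE.
exact: subset_trans Inn_sub_Aut (acts_Gm _ _).
Qed.

End Equivalences.

Local Open Scope ring_scope.

Theorem theorem3p1 (gT : finGroupType) (m : nat) (hm : (0 < m)%N) :
  [/\ num_weak_equiv gT m = (\sum_(0 <= k < (m %/ 2).+1) #|Gmk_orbits m k (Aut [set: gT])|)%N,
      (num_weak_equiv gT m)%:R = \sum_(0 <= k < (m %/ 2).+1)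
        (\sum_(p in HK m k (Aut [set: gT])) #|Fix_barG p|%:R)
          / (#|Aut [set: gT]| * k`! * (m - 2 * k)`!)%:R :> rat,
      num_equiv gT m = (\sum_(0 <= k < (m %/ 2).+1) #|Gmk_orbits m k (Inn gT)|)%N
    & (num_equiv gT m)%:R = \sum_(0 <= k < (m %/ 2).+1)
        (\sum_(p in HK m k (Inn gT)) #|Fix_barG p|%:R)
          / (#|Inn gT| * k`! * (m - 2 * k)`!)%:R :> rat].
Proof.
rewrite num_weak_equivE num_equivE; split.
- exact: card_orbits_Gm.
- exact: card_orbits_Gm_Fix.
- exact: card_orbits_Gm (Inn_sub_Aut gT).
- exact: card_orbits_Gm_Fix (Inn_sub_Aut gT).
Qed.
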